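(* A quasi-periodic non-linear bicycle path $(\mathbf{x}(t),\mathbf{y}(t))$, $t\in\mathbb{R}$, is not a global minimizer.
   Context: A bicycle path in $\mathbb{R}^n$, $n\ge2$, is a pair of curves $(\mathbf{x}(t),\mathbf{y}(t))$ in $\mathbb{R}^n$ (front and back tracks) such that $\mathbf{v}:=\mathbf{x}-\mathbf{y}$ satisfies $|\mathbf{v}|=1$ and $\mathbf{y}'(t)$ is parallel to $\mathbf{v}(t)$ for all $t$ (with $\mathbf{y}'=0$ allowed; competing paths may be piecewise smooth). Its length is the length of its front track $\mathbf{x}(t)$, and the path is parametrized so that $|\mathbf{x}'|=1$. The bicycle path is non-linear if its front track is not contained in a straight line. It is quasi-periodic if there exist $T>0$ and an isometry $M$ of $\mathbb{R}^n$ such that $\mathbf{x}(t+T)=M(\mathbf{x}(t))$ and $\mathbf{y}(t+T)=M(\mathbf{y}(t))$ for all $t\in\mathbb{R}$. A bicycle path $(\mathbf{x}(t),\mathbf{y}(t))$, $t\in\mathbb{R}$, is a global minimizer if each of its finite subsegments has minimal length among all bicycle paths connecting its initial placement $(\mathbf{x}(t_0),\mathbf{y}(t_0))$ to its final placement $(\mathbf{x}(t_1),\mathbf{y}(t_1))$. *)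

(* Defs.v *)
From HB Require Import structures.
From mathcomp Require Import all_boot all_order all_algebra.
From mathcomp Require Import all_classical all_reals all_analysis.
Import Order.TTheory GRing.Theory Num.Theory.
Import numFieldNormedType.Exports.
Set Implicit Arguments.
Unset Strict Implicit.
Unset Printing Implicit Defensive.
Local Open Scope classical_set_scope.
Local Open Scope ring_scope.

(* The library's norm on 'rV[R]_n is the sup norm.  It is used below only for
   derivatives, which do not depend on the choice of norm; all metric notions
   refer to the Euclidean norm. *)
Definition enorm (R : realType) (n : nat) (v : 'rV[R]_n) : R :=
  Num.sqrt (\sum_(i < n) v ord0 i ^+ 2).

Definition euclidean_isometry (R : realType) (n : nat)
    (M : 'rV[R]_n -> 'rV[R]_n) : Prop :=
  forall p q, enorm (M p - M q) = enorm (p - q).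

Definition smooth (R : realType) (n : nat) (f : R -> 'rV[R]_n) : Prop :=
  forall (k : nat) (t : R), derivable (derive1n k f) t 1.

(* Smoothness up to the endpoints of a closed interval: f coincides there with
   a curve that is smooth on the whole line. *)
Definition smooth_on (R : realType) (n : nat) (a b : R)
    (f : R -> 'rV[R]_n) : Prop :=
  exists2 g : R -> 'rV[R]_n, smooth g & {in `[a, b], f =1 g}.

(* s = [:: t_1; ...; t_m] stands for the subdivision
   a = t_0 < t_1 < ... < t_m = b; consecutive pieces share an endpoint, so f is
   continuous on [a, b]. *)
Definition piecewise_smooth (R : realType) (n : nat) (a b : R)
    (f : R -> 'rV[R]_n) : Prop :=
  exists2 s : seq R, itv_partition a b s &
    forall i : nat, (i < size s)%N -> smooth_on (nth b (a :: s) i) (nth b s i) f.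

(* The restriction of (x, y) to [a, b] is a bicycle path with front track x and
   back track y.  The two conditions on derivatives are imposed wherever the
   derivative exists, that is, off finitely many corners; at a corner they pass
   to the one-sided derivatives by continuity.  In the parallelism condition,
   x t - y t is nonzero and c may be 0. *)
Definition bicycle_path_on (R : realType) (n : nat) (a b : R)
    (x y : R -> 'rV[R]_n) : Prop :=
  [/\ piecewise_smooth a b x,
      piecewise_smooth a b y,
      forall t, a <= t <= b -> enorm (x t - y t) = 1,
      forall t, a < t < b -> derivable y t 1 ->
        exists c : R, derive1 y t = c *: (x t - y t) &
      forall t, a < t < b -> derivable x t 1 -> enorm (derive1 x t) = 1].

Definition bicycle_path (R : realType) (n : nat) (x y : R -> 'rV[R]_n) : Prop :=
  forall a b : R, a < b -> bicycle_path_on a b x y.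

(* For a piecewise smooth curve the derivative exists off a finite set, and the
   values of the total function derive1 x on that set do not affect the integral. *)
Definition curve_length (R : realType) (n : nat) (a b : R)
    (x : R -> 'rV[R]_n) : \bar R :=
  (\int[@lebesgue_measure R]_(t in `[a, b]) (enorm (derive1 x t))%:E)%E.

Definition non_linear (R : realType) (n : nat) (x : R -> 'rV[R]_n) : Prop :=
  ~ exists p d : 'rV[R]_n,
      d != 0 /\ forall t, exists c : R, x t = p + c *: d.

Definition quasi_periodic (R : realType) (n : nat)
    (x y : R -> 'rV[R]_n) : Prop :=
  exists T : R, exists M : 'rV[R]_n -> 'rV[R]_n,
    [/\ 0 < T, euclidean_isometry M,
        forall t, x (t + T) = M (x t) &
        forall t, y (t + T) = M (y t)].

Definition global_minimizer (R : realType) (n : nat)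
    (x y : R -> 'rV[R]_n) : Prop :=
  forall t0 t1 : R, t0 < t1 ->
  forall (a b : R) (x' y' : R -> 'rV[R]_n),
    a <= b -> bicycle_path_on a b x' y' ->
    x' a = x t0 -> y' a = y t0 -> x' b = x t1 -> y' b = y t1 ->
    (curve_length t0 t1 x <= curve_length a b x')%E.

(* Main.v *)
Require Import Defs.
From mathcomp Require Import all_boot all_order all_algebra.
From mathcomp Require Import all_classical all_reals all_analysis.
From mathcomp Require Import measurable_realfun ring lra.
Import Order.TTheory GRing.Theory Num.Theory.
Import numFieldNormedType.Exports.
Set Implicit Arguments.
Unset Strict Implicit.
Unset Printing Implicit Defensive.
Local Open Scope classical_set_scope.
Local Open Scope ring_scope.

(** A non-linear front track must fall short of straightness somewhere, a
    quasi-periodic path repeats that waste in every period, and the accumulated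
    waste eventually exceeds what it costs to turn the bicycle around twice.

    Upper bound for minimizers.  Any two placements (p, q) and (p', q') are
    joined by a bicycle path of length at most |q' - q| + 4 pi
    ([placements_joined]): with the back wheel fixed at q, rotate the frame
    until it points towards q'; ride straight until the back wheel is at q';
    rotate again.  Each rotation moves the front wheel along a unit circle, by an angle
    of at most 2 pi.  Since front and back wheels are at distance 1 and the
    front track has unit speed, a global minimizer satisfies
    b - a <= |x b - x a| + 2 + 4 pi for all a < b ([minimizer_le]).

    Waste per period.  The front track is 1-Lipschitz ([bicycle_front_le]).  If
    |x b - x a| = b - a held for all a <= b, then x would be an isometric
    embedding of the real line in a Euclidean space, hence a line
    ([isometric_linear]).  So a non-linear path has a <= b with
    |x b - x a| = (b - a) - eps for some eps > 0.  Let P be a multiple of the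
    quasi-period with P > b - a; then |x (a + P) - x a| <= P - eps.  The
    isometry carries this chord to each of the following chords over [a + j P,
    a + (j + 1) P], and the triangle inequality gives
    |x (a + m P) - x a| <= m (P - eps).  For a global minimizer this forces
    m P <= m (P - eps) + 2 + 4 pi for every m > 0, which fails for large m. *)

(** * Euclidean norm and scalar product *)

Section Euclidean.
Context {R : realType} {n : nat}.
Implicit Types u v w : 'rV[R]_n.

Definition dot u v : R := \sum_(i < n) u ord0 i * v ord0 i.

Lemma dotC u v : dot u v = dot v u.
Proof. by apply: eq_bigr => i _; rewrite mulrC. Qed.

Lemma dotDl u v w : dot (u + v) w = dot u w + dot v w.
Proof. by rewrite -big_split; apply: eq_bigr => i _; rewrite mxE mulrDl. Qed.

Lemma dotZl (a : R) u w : dot (a *: u) w = a * dot u w.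
Proof. by rewrite mulr_sumr; apply: eq_bigr => i _; rewrite mxE mulrA. Qed.

Lemma dotNl u w : dot (- u) w = - dot u w.
Proof. by rewrite -scaleN1r dotZl mulN1r. Qed.

Lemma dotDr u v w : dot w (u + v) = dot w u + dot w v.
Proof. by rewrite dotC dotDl !(dotC _ w). Qed.

Lemma dotZr (a : R) u w : dot w (a *: u) = a * dot w u.
Proof. by rewrite dotC dotZl (dotC w). Qed.

Lemma dotNr u w : dot w (- u) = - dot w u.
Proof. by rewrite dotC dotNl (dotC w). Qed.

Definition dotE := (dotDl, dotDr, dotNl, dotNr, dotZl, dotZr).

Lemma dot_ge0 u : 0 <= dot u u.
Proof. by apply: sumr_ge0 => i _; rewrite -expr2 sqr_ge0. Qed.

Lemma dot_eq0 u : (dot u u == 0) = (u == 0).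
Proof.
apply/idP/eqP => [|->]; last first.
  by apply/eqP; rewrite -(scale0r 0) dotZl mul0r.
rewrite psumr_eq0; last by move=> i _; rewrite -expr2 sqr_ge0.
move/allP => h; apply/rowP => i; rewrite mxE.
by have := h i (mem_index_enum i); rewrite -expr2 sqrf_eq0 => /eqP.
Qed.

Lemma enorm_sqr u : enorm u ^+ 2 = dot u u.
Proof.
rewrite /enorm (_ : \sum_(i < n) _ = dot u u); last first.
  by apply: eq_bigr => i _; rewrite expr2.
by rewrite sqr_sqrtr// dot_ge0.
Qed.

Lemma enorm_ge0 u : 0 <= enorm u.
Proof. exact: sqrtr_ge0. Qed.

Lemma enorm_eq u (r : R) : 0 <= r -> dot u u = r ^+ 2 -> enorm u = r.
Proof.
move=> r0 h; apply/eqP; rewrite -(@eqrXn2 _ 2)//; last exact: enorm_ge0.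
by rewrite enorm_sqr h.
Qed.

Lemma enorm_eq0 u : (enorm u == 0) = (u == 0).
Proof. by rewrite -dot_eq0 -enorm_sqr sqrf_eq0. Qed.

Lemma enorm_gt0 u : (0 < enorm u) = (u != 0).
Proof. by rewrite lt0r enorm_ge0 andbT enorm_eq0. Qed.

Lemma enormN u : enorm (- u) = enorm u.
Proof. by apply: enorm_eq; rewrite ?enorm_ge0// enorm_sqr !dotE opprK. Qed.

Lemma enormB u v : enorm (u - v) = enorm (v - u).
Proof. by rewrite -enormN opprB. Qed.

(** Cauchy-Schwarz: expand the square of | |v| u - |u| v |. *)
Lemma dot_le u v : dot u v <= enorm u * enorm v.
Proof.
have [->|u0] := eqVneq u 0.
  by rewrite -(scale0r 0) dotZl mul0r mulr_ge0// enorm_ge0.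
have [->|v0] := eqVneq v 0.
  by rewrite -(scale0r 0) dotZr mul0r mulr_ge0// enorm_ge0.
have hu : 0 < enorm u by rewrite enorm_gt0.
have hv : 0 < enorm v by rewrite enorm_gt0.
have := dot_ge0 (enorm v *: u - enorm u *: v).
rewrite !dotE -!enorm_sqr (dotC v u) => h.
rewrite -subr_ge0 -(pmulr_rge0 _ (mulr_gt0 hu hv)) -(pmulr_rge0 _ (ltr0n R 2)).
by apply: le_trans h _; rewrite le_eqVlt; apply/orP; left; apply/eqP; ring.
Qed.

Lemma enormD u v : enorm (u + v) <= enorm u + enorm v.
Proof.
rewrite -(@ler_pXn2r _ 2) ?nnegrE ?addr_ge0 ?enorm_ge0//.
rewrite enorm_sqr !dotE (dotC v u) -!enorm_sqr.
by have := dot_le u v; nra.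
Qed.

Lemma enorm_tri v u w : enorm (u - w) <= enorm (u - v) + enorm (v - w).
Proof. by rewrite -[u - w](subrKA v) enormD. Qed.

(** In dimension at least 2 the kernel of the pairing with v is nonzero. *)
Lemma exists_unit_orth v : (2 <= n)%N ->
  exists2 w, dot v w = 0 & dot w w = 1.
Proof.
move=> n2; pose w0 := nz_row (kermx v^T).
have w0n : w0 != 0.
  rewrite nz_row_eq0 -mxrank_eq0 mxrank_ker -lt0n subn_gt0.
  by rewrite (leq_ltn_trans (rank_leq_col _)).
have /sub_kermxP w0v : (w0 <= kermx v^T)%MS by exact: nz_row_sub.
have dw : dot v w0 = 0.
  have /matrixP/(_ ord0 ord0) := w0v; rewrite !mxE => <-.
  by rewrite dotC; apply: eq_bigr => i _; rewrite mxE.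
exists ((enorm w0)^-1 *: w0); rewrite !dotE ?dw ?mulr0//.
by rewrite -enorm_sqr expr2 mulKf ?mulVf// enorm_eq0.
Qed.

(** The angle produced is pi + acos (- u.v).  Among the angles with cosine u.v
    this one is bounded away from 0 even when u = v, so that the arc swept
    between u and v always takes up a nonempty time interval. *)
Lemma exists_rotation u v : (2 <= n)%N -> dot u u = 1 -> dot v v = 1 ->
  exists w (th : R), [/\ dot u w = 0, dot w w = 1, 0 < th <= 2 * pi &
    cos th *: u + sin th *: w = v].
Proof.
move=> n2 u1 v1; set c := dot u v; set r := v - c *: u.
have eu : enorm u = 1 by apply: enorm_eq; rewrite // u1 expr1n.
have ev : enorm v = 1 by apply: enorm_eq; rewrite // v1 expr1n.
have c1 : -1 <= - c <= 1.
  have := dot_le u v; have := dot_le (- u) v.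
  by rewrite enormN eu ev mulr1 dotNl -/c => h1 h2; apply/andP; split; lra.
have rr : dot r r = 1 - c ^+ 2.
  by rewrite /r !dotE u1 v1 (dotC v u) -/c; ring.
have ur : dot u r = 0 by rewrite /r !dotE u1 -/c; ring.
have rE : v = r + c *: u by rewrite subrK.
clearbody r.
have [w [uw w1 rw]] : exists w,
    [/\ dot u w = 0, dot w w = 1 & r = - enorm r *: w].
  (* u and v are parallel: any direction orthogonal to u will do *)
  have [r0|r0] := eqVneq r 0.
    have [w uw w1] := exists_unit_orth u n2; exists w; split => //.
    by move/eqP: (r0); rewrite -enorm_eq0 => /eqP ->; rewrite r0 oppr0 scale0r.
  exists (- (enorm r)^-1 *: r); rewrite !dotE ur mulr0; split=> //.
    rewrite -enorm_sqr expr2 mulrA mulrNN -expr2 -exprMn.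
    by rewrite mulVf ?expr1n// enorm_eq0.
  by rewrite scalerA mulrNN divff ?scale1r// enorm_eq0.
exists w, (acos (- c) + pi); split => //.
  have := acos_ge0 c1; have := acos_lepi c1; have := pi_gt0 R.
  by move=> *; apply/andP; split; lra.
rewrite cosDpi sinDpi acosK ?sin_acos// opprK sqrrN -rr.
rewrite (_ : Num.sqrt _ = enorm r); last first.
  by rewrite -enorm_sqr sqrtr_sqr ger0_norm// enorm_ge0.
by rewrite -rw rE addrC.
Qed.

(** The two distances determine u.w = t, and then |w - t u|^2 = 0. *)
Lemma on_unit_line u w (t : R) : dot u u = 1 -> dot w w = t ^+ 2 ->
  dot (w - u) (w - u) = (t - 1) ^+ 2 -> w = t *: u.
Proof.
move=> u1 ww; rewrite !dotE u1 ww (dotC u w) => wu.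
have {}wu : dot w u = t by move: wu; lra.
apply/eqP; rewrite -subr_eq0 -dot_eq0 !dotE u1 ww (dotC u w) wu.
by apply/eqP; ring.
Qed.

End Euclidean.

(** * Derivatives of curves *)

Section Calculus.
Context {R : realType} {n : nat}.
Implicit Types (f g : R -> 'rV[R]_n).

Lemma is_derive_scale (k : R -> R) (t dk : R) (v : 'rV[R]_n) :
  is_derive t 1 k dk -> is_derive t 1 (fun s => k s *: v) (dk *: v).
Proof.
move=> [/derivable1_diffP dk1 dk2].
apply: DeriveDef; first exact/derivable1_diffP/differentiableZl.
rewrite deriveE; last exact: differentiableZl.
by rewrite diffZl//= -deriveE// dk2.
Qed.

Lemma is_derive_dot g (t : R) dg w : is_derive t 1 g dg ->
  is_derive t 1 (fun s => dot (g s) w) (dot dg w).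
Proof.
move=> [dg1 <-].
have h i : is_derive t 1 (fun s => g s ord0 i * w ord0 i)
                         (('D_1 g t) ord0 i * w ord0 i).
  have gi : derivable (fun s => g s ord0 i) t 1.
    exact: (proj1 (derivable_mxP g t 1) dg1 ord0 i).
  rewrite (derive_mx dg1) mxE.
  have := is_deriveM (derivableP gi) (is_derive_cst (w ord0 i) t 1).
  by move/is_derive_eq; apply; rewrite scaler0 add0r /= mulrC.
have := is_derive_sum h.
rewrite (_ : \sum_(i < n) _ = (fun s => dot (g s) w))//.
by apply/funext => s; rewrite fct_sumE.
Qed.

(** Where it exists, a derivative is the limit of the difference quotients from
    the right.  At the junction of two smooth pieces this identifies it with the
    derivative of the second piece. *)
Lemma derive1_eq_right f g (t c : R) : t < c -> {in `[t, c], f =1 g} ->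
  derivable f t 1 -> derivable g t 1 -> derive1 f t = derive1 g t.
Proof.
have cvgq h : derivable h t 1 ->
    cvg ((fun s => s^-1 *: (h (s + t) - h t)) @ 0^').
  rewrite /derivable; set a := fun _ => _; set b := fun _ => _.
  suff -> : a = b by [].
  by apply/funext => s; rewrite /a /b /= [_%:A]mulr1.
move=> tc fg /cvgq cf /cvgq cg.
rewrite /derive1 (cvg_at_rightE _ _ cf) (cvg_at_rightE _ _ cg).
have E : \forall s \near (0:R)^'+,
    s^-1 *: (f (s + t) - f t) = s^-1 *: (g (s + t) - g t).
  near=> s; rewrite (fg t) ?in_itv/= ?lexx ?ltW// fg// in_itv/= lerDr -lerBrDr.
  apply/andP; split; first by near: s; exact: nbhs_right_ge.
  by near: s; apply: nbhs_right_le; rewrite subr_gt0.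
congr (lim _); rewrite eqEsubset; split; apply: near_eq_cvg => //.
by apply: filterS E => s ->.
Unshelve. all: by end_near. Qed.

Lemma near_eq_itv f g (u v t : R) : u < t < v -> {in `[u, v], f =1 g} ->
  {near t, f =1 g}.
Proof.
move=> utv fg; near=> s; apply: fg; apply: subset_itv_oo_cc.
by near: s; apply: near_in_itvoo; rewrite in_itv.
Unshelve. all: by end_near. Qed.

Lemma near_eq_derivable1 f g (t : R) : {near t, f =1 g} ->
  derivable f t 1 -> derivable g t 1 /\ derive1 f t = derive1 g t.
Proof.
move=> fg df; split; first exact: near_eq_derivable fg df.
by rewrite !derive1E; exact: near_eq_derive.
Qed.

Lemma smooth_is_derive g (t : R) : smooth g -> is_derive t 1 g (derive1 g t).
Proof. by move=> /(_ 0%N t) h; rewrite derive1E; exact: derivableP. Qed.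

End Calculus.

(** * Superpositions of a translation and a rotation *)

Section Trochoid.
Context {R : realType} {n : nat}.
Implicit Types p u v w : 'rV[R]_n.

(** Straight rides and rotations of the frame are both of this form, and the
    family is closed under differentiation ([derive1_trochoid]), so that
    smoothness of all its members follows by induction on the order of the
    derivative. *)
Definition trochoid (c : R) p u v w (t : R) : 'rV[R]_n :=
  p + (t - c) *: u + cos (t - c) *: v + sin (t - c) *: w.

Lemma is_derive_trochoid (c : R) p u v w (t : R) :
  is_derive t 1 (trochoid c p u v w) (trochoid c u 0 w (- v) t).
Proof.
have ds : is_derive t 1 (fun s : R => s - c) 1.
  have := is_deriveD (is_derive_id t 1) (is_derive_cst (- c) t 1).
  by rewrite addr0.
have dcs (f : R -> R) df : is_derive (t - c) 1 f df ->
    is_derive t 1 (fun s : R => f (s - c)) df.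
  move=> hf; have := @is_derive1_comp R f (fun s : R => s - c) t df 1 hf ds.
  by rewrite mulr1.
have d1 := is_derive_scale u ds.
have d2 := is_derive_scale v (dcs _ _ (is_derive_cos (t - c))).
have d3 := is_derive_scale w (dcs _ _ (is_derive_sin (t - c))).
have := is_deriveD (is_deriveD (is_deriveD (is_derive_cst p t 1) d1) d2) d3.
move/is_derive_eq; apply.
rewrite /trochoid scaler0 add0r addr0 scale1r scalerN scaleNr -!addrA.
by rewrite [X in _ + X]addrC.
Qed.

Lemma derive1_trochoid (c : R) p u v w (t : R) :
  derive1 (trochoid c p u v w) t = trochoid c u 0 w (- v) t.
Proof. by rewrite derive1E; case: (is_derive_trochoid c p u v w t). Qed.

Lemma trochoid_start (c : R) p u v w : trochoid c p u v w c = p + v.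
Proof. by rewrite /trochoid subrr cos0 sin0 !scale0r scale1r !addr0. Qed.

Lemma trochoid_shift (c l : R) p u v w :
  trochoid c p u v w (c + l) = p + l *: u + cos l *: v + sin l *: w.
Proof. by rewrite /trochoid [c + l]addrC addrK -!addrA. Qed.

Lemma smooth_trochoid (c : R) p u v w : smooth (trochoid c p u v w).
Proof.
move=> k t; elim: k p u v w => [|k IH] p u v w.
  by rewrite derive1n0; case: (is_derive_trochoid c p u v w t).
rewrite derive1Sn (_ : derive1 _ = trochoid c u 0 w (- v))//.
by apply/funext => s; exact: derive1_trochoid.
Qed.

End Trochoid.

(** * Subdivisions of an interval *)

Section Subdivision.
Context {R : realType}.
Implicit Types (s : seq R) (f : R -> R).

Lemma piece_of (d a t : R) s : path <%R a s -> a <= t <= last a s ->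
  t \notin a :: s ->
  exists2 i, (i < size s)%N & nth d (a :: s) i < t < nth d s i.
Proof.
elim: s a => [|b s IH] a /=.
  by move=> _ /le_anti ->; rewrite inE eqxx.
move=> /andP[ab bs] /andP[at_ tl]; rewrite !inE !negb_or => /and3P[ta tb ts].
have [t_b|b_t] := ltP t b.
  by exists 0%N => //=; rewrite t_b lt_neqAle at_ eq_sym ta.
have [||i si hi] := IH b bs; first by rewrite b_t.
  by rewrite inE negb_or tb.
by exists i.+1.
Qed.

Lemma increment_le (d K a : R) s f : path <%R a s ->
  (forall i, (i < size s)%N ->
     f (nth d s i) - f (nth d (a :: s) i) <=
       K * (nth d s i - nth d (a :: s) i)) ->
  f (last a s) - f a <= K * (last a s - a).
Proof.
elim: s a => [|b s IH] a /=; first by rewrite !subrr mulr0.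
move=> /andP[ab bs] h.
have := h 0%N isT; have := IH b bs (fun i hi => h i.+1 hi) => /=.
by rewrite !mulrBr; lra.
Qed.

Lemma piece_bounds (a b : R) s i : itv_partition a b s -> (i < size s)%N ->
  [/\ a <= nth b (a :: s) i, nth b (a :: s) i < nth b s i & nth b s i <= b].
Proof.
move=> abs si; split.
- by apply: itv_partition_nth_ge abs; rewrite ltnS ltnW.
- by case: abs => /(pathP b)/(_ i si).
- exact: (@itv_partition_nth_le _ _ _ _ s i.+1 _ abs).
Qed.

End Subdivision.

(** * Length and speed of piecewise smooth curves *)

Section Path.
Context {R : realType} {n : nat}.
Implicit Types (x y g : R -> 'rV[R]_n).

Lemma piecewise_derivable (a b : R) x : piecewise_smooth a b x ->
  exists2 s : seq R, a \in s /\ b \in s &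
    forall t, a <= t <= b -> t \notin s -> derivable x t 1.
Proof.
move=> [s abs hs]; exists (a :: s).
  split; first exact: mem_head.
  by case: abs => _ /eqP <-; exact: mem_last.
move=> t tab ts; case: (abs) => pas /eqP lab.
have [|i si hi] := piece_of b pas _ ts; first by rewrite lab.
have [g sg xg] := hs i si.
apply: (@near_eq_derivable _ _ _ g).
  by have := near_eq_itv hi xg; apply: filterS => r /esym.
exact: (sg 0%N t).
Qed.

(** The integrand is 1 off the finitely many corners.  Whatever its values at
    the corners, it is measurable, because all subsets of a countable set of
    reals are measurable. *)
Lemma curve_length_unit (a b : R) x : a <= b -> piecewise_smooth a b x ->
  (forall t, a < t < b -> derivable x t 1 -> enorm (derive1 x t) = 1) ->
  curve_length a b x = (b - a)%:E.
Proof.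
move=> ab /piecewise_derivable[s [sa sb] ds] h1.
pose S : set R := [set t | t \in s].
have cS : countable S by apply: finite_set_countable; exact: finite_seq.
have mS : measurable S by apply: countable_measurable.
have E t : `[a, b]%classic t -> ~ S t -> (enorm (derive1 x t))%:E = 1%:E.
  rewrite /= in_itv/= => /andP[a_t t_b] /negP tS.
  rewrite h1//; last by apply: ds; rewrite ?a_t.
  rewrite !lt_neqAle a_t t_b !andbT; apply/andP; split.
    by apply: contra tS => /eqP <-.
  by apply: contra tS => /eqP ->.
have mD : measurable_fun `[a, b] (fun t => (enorm (derive1 x t))%:E).
  rewrite -(setUIDK `[a, b] S).
  apply/measurable_funU; [exact: measurableI|exact: measurableD|split=> //].
    move=> _ Y _; apply: countable_measurable => //.
    by apply: sub_countable cS; apply: subset_card_le => t [[]].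
  apply: (eq_measurable_fun (cst 1%:E)) => [t|]; last exact: measurable_cst.
  by rewrite inE => -[tab tS]; rewrite E.
rewrite /curve_length (ge0_ae_eq_integral (g := cst 1%:E))//.
- rewrite integral_cst// mul1e /= lebesgue_measure_itv/= lte_fin.
  by case: ltgtP ab => // -> _; rewrite subrr.
- by move=> t _; rewrite lee_fin enorm_ge0.
- exists S; split=> //; first exact: countable_lebesgue_measure0.
  by move=> t /=; apply: contra_notP => tS tab; exact: E.
Qed.

(** Let w be the chord x b - x a.  On each piece the mean value theorem for
    <x, w>, whose derivative is at most |w| by Cauchy-Schwarz, bounds the
    increment; the sum of the bounds is |w|^2 <= |w| (b - a). *)
Lemma front_lipschitz (a b : R) x : a <= b -> piecewise_smooth a b x ->
  (forall t, a < t < b -> derivable x t 1 -> enorm (derive1 x t) = 1) ->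
  enorm (x b - x a) <= b - a.
Proof.
move=> ab [s abs hs] h1; set w := x b - x a.
have [pas /eqP lab] := abs.
suff H : dot w w <= enorm w * (b - a).
  have [->|w0] := eqVneq w 0; last first.
    by rewrite -(ler_pM2l (_ : 0 < enorm w)) ?enorm_gt0// -expr2 enorm_sqr.
  by rewrite (eqP (_ : enorm 0 == 0)) ?enorm_eq0 ?subr_ge0.
rewrite {1}/w dotDl dotNl -lab.
apply: (@increment_le R b (enorm w) a s (fun t => dot (x t) w) pas) => i si.
have [au uv vb] := piece_bounds abs si.
have [g sg xg] := hs i si.
move: (nth b (a :: s) i) (nth b s i) au uv vb xg => u v au uv vb xg.
have dg t := is_derive_dot w (smooth_is_derive t sg).
rewrite !xg ?in_itv/= ?lexx ?(ltW uv)//.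
have [|t tuv ->] := MVT uv (fun t _ => dg t).
  apply: derivable_within_continuous => t _.
  by have [] := dg t.
apply: ler_wpM2r; first by rewrite subr_ge0 ltW.
have gx : {near t, g =1 x}.
  by have := near_eq_itv tuv xg; apply: filterS => r /esym.
have [xd ->] := near_eq_derivable1 gx (sg 0%N t).
apply: le_trans (dot_le _ _) _.
rewrite h1 ?mul1r//.
move: tuv; rewrite in_itv/= => /andP[ut tv]; apply/andP.
by split; [exact: le_lt_trans ut|exact: lt_le_trans vb].
Qed.

End Path.

(** * Paths joining two placements *)

Section Competitors.
Context {R : realType} {n : nat}.
Implicit Types (x y g : R -> 'rV[R]_n) (p q u v : 'rV[R]_n).

(** Competitors are assembled from pieces that satisfy the bicycle conditions on
    the whole line, so that at a junction the conditions can be read off from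
    the next piece. *)
Definition smooth_bicycle x y : Prop :=
  [/\ smooth x, smooth y, forall t, enorm (x t - y t) = 1,
      forall t, exists c : R, derive1 y t = c *: (x t - y t) &
      forall t, enorm (derive1 x t) = 1].

Lemma smooth_bicycle_on (a b : R) x y : a < b -> smooth_bicycle x y ->
  bicycle_path_on a b x y.
Proof.
move=> ab [sx sy xy1 yx x1]; split=> //.
- by exists [:: b]; [exact: itv_partition1|case=> // _; exists x].
- by exists [:: b]; [exact: itv_partition1|case=> // _; exists y].
Qed.

Definition glue (b : R) x g : R -> 'rV[R]_n :=
  fun t => if t <= b then x t else g t.

Lemma glue_left (a b : R) x g : {in `[a, b], glue b x g =1 x}.
Proof. by move=> t; rewrite in_itv/= /glue => /andP[_ ->]. Qed.

Lemma glue_right (b c : R) x g : x b = g b -> {in `[b, c], glue b x g =1 g}.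
Proof.
move=> xg t; rewrite in_itv/= /glue => /andP[bt _].
by case: (leP t b) => // tb; rewrite (@le_anti _ _ t b) ?tb.
Qed.

Lemma piecewise_smooth_glue (a b c : R) x g : b < c ->
  piecewise_smooth a b x -> smooth g -> x b = g b ->
  piecewise_smooth a c (glue b x g).
Proof.
move=> bc [s abs hs] sg xg.
exists (s ++ [:: c]); first exact: itv_partition_cat abs (itv_partition1 bc).
move=> i; rewrite size_cat addn1 ltnS leq_eqVlt => /orP[/eqP ->|si].
  exists g => //; have [_ /eqP lab] := abs.
  rewrite -cat_cons nth_cat/= ltnSn -(last_nth c) lab.
  by rewrite nth_cat ltnn subnn; exact: glue_right.
have si' : (i < size (a :: s))%N by exact: ltnW.
have [_ _ vb] := piece_bounds abs si; have [h sh xh] := hs i si.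
exists h => // t; rewrite -cat_cons !nth_cat si si'.
rewrite (set_nth_default b c si) (set_nth_default b c si') => tI.
rewrite -xh// (@glue_left (nth b (a :: s) i) b)//.
by move: tI; rewrite !in_itv/= => /andP[-> /le_trans ->].
Qed.

(** Before b the glued path is locally the old one; from b on its derivatives,
    where they exist, are those of the new piece by [derive1_eq_right]. *)
Lemma bicycle_path_on_glue (a b c : R) x y gx gy : a < b -> b < c ->
  bicycle_path_on a b x y -> smooth_bicycle gx gy -> x b = gx b -> y b = gy b ->
  bicycle_path_on a c (glue b x gx) (glue b y gy).
Proof.
move=> ab bc [px py xy1 yx x1] [sx sy gxy1 gyx gx1] xb yb.
have dright z g t : z b = g b -> smooth g -> b <= t < c ->
    derivable (glue b z g) t 1 -> derive1 (glue b z g) t = derive1 g t.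
  move=> zg sg /andP[bt tc] dz; apply: (derive1_eq_right tc _ dz (sg 0%N t)).
  move=> s; rewrite in_itv/= => /andP[ts sc].
  by apply: (glue_right zg (c := c)); rewrite in_itv/= sc (le_trans bt).
have nleft z g t : a < t < b -> {near t, glue b z g =1 z}.
  by move=> atb; apply: (near_eq_itv atb); exact: glue_left.
split.
- exact: piecewise_smooth_glue.
- exact: piecewise_smooth_glue.
- move=> t /andP[a_t tc]; rewrite /glue; case: leP => // tb.
  by rewrite xy1// a_t.
- move=> t /andP[a_t tc]; case: (ltP t b) => tb dy.
    have atb : a < t < b by rewrite a_t.
    have nx := nleft x gx t atb; have ny := nleft y gy t atb.
    have [dy' ->] := near_eq_derivable1 ny dy.
    by rewrite (nbhs_singleton nx) (nbhs_singleton ny); exact: yx.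
  by rewrite dright// ?tb// !(glue_right (c := c)) ?in_itv/= ?tb ?ltW.
- move=> t /andP[a_t tc]; case: (ltP t b) => tb dx.
    have atb : a < t < b by rewrite a_t.
    have nx := nleft x gx t atb.
    by have [dx' ->] := near_eq_derivable1 nx dx; exact: x1.
  by rewrite dright// tb.
Qed.

(** The starting time c is arbitrary, so that a maneuver can be appended to any
    path. *)
Definition maneuver (l : R) p q p' q' : Prop := forall c : R,
  exists x y, [/\ smooth_bicycle x y, x c = p, y c = q,
                  x (c + l) = p' & y (c + l) = q'].

Definition joined (l : R) p q p' q' : Prop := exists (a b : R) x y,
  [/\ a < b, b - a = l, bicycle_path_on a b x y &
      [/\ x a = p, y a = q, x b = p' & y b = q']].

Lemma maneuver_joined (l : R) p q p' q' : 0 < l ->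
  maneuver l p q p' q' -> joined l p q p' q'.
Proof.
move=> l0 /(_ 0)[x [y [xy xp yq]]]; rewrite add0r => xp' yq'.
by exists 0, l, x, y; split=> //; [rewrite subr0|exact: smooth_bicycle_on].
Qed.

Lemma joined_maneuver (k l : R) p q p' q' p'' q'' : 0 < l ->
  joined k p q p' q' -> maneuver l p' q' p'' q'' -> joined (k + l) p q p'' q''.
Proof.
move=> l0 [a [b [x [y [ab bak xy [xp yq xp' yq']]]]]].
move=> /(_ b)[gx [gy [gxy gp gq gp' gq']]].
have bl : b < b + l by rewrite ltrDl.
exists a, (b + l), (glue b x gx), (glue b y gy); split.
- exact: lt_trans bl.
- by rewrite addrAC bak.
- by apply: bicycle_path_on_glue => //; congruence.
- by rewrite /glue ltW// leNgt bl/=; split.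
Qed.

Lemma maneuver_rotate q u v : (2 <= n)%N -> dot u u = 1 -> dot v v = 1 ->
  exists2 l : R, 0 < l <= 2 * pi & maneuver l (q + u) q (q + v) q.
Proof.
move=> n2 u1 v1; have [w [th [uw w1 th0 uwv]]] := exists_rotation n2 u1 v1.
exists th => // c.
exists (trochoid c q 0 u w), (trochoid c q 0 0 0).
have d (s : R) : dot (cos s *: u + sin s *: w) (cos s *: u + sin s *: w) = 1.
  have := cos2Dsin2 s; rewrite !dotE u1 w1 (dotC w u) uw !expr2; lra.
have d' (s : R) : dot (cos s *: w - sin s *: u) (cos s *: w - sin s *: u) = 1.
  have := cos2Dsin2 s; rewrite !dotE u1 w1 (dotC w u) uw !expr2; lra.
split; [split| | | |].
- exact: smooth_trochoid.
- exact: smooth_trochoid.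
- move=> t; apply: enorm_eq; rewrite // expr1n -[RHS](d (t - c)).
  by congr dot; apply/rowP => i; rewrite !mxE; ring.
- move=> t; exists 0.
  by rewrite derive1_trochoid /trochoid oppr0 !scaler0 !addr0 scale0r.
- move=> t; rewrite derive1_trochoid /trochoid !scaler0 !add0r scalerN.
  by apply: enorm_eq; rewrite // d' expr1n.
- by rewrite trochoid_start.
- by rewrite trochoid_start addr0.
- by rewrite trochoid_shift scaler0 addr0 -addrA uwv.
- by rewrite trochoid_shift !scaler0 !addr0.
Qed.

Lemma maneuver_straight (l : R) q u : dot u u = 1 ->
  maneuver l (q + u) q (q + l *: u + u) (q + l *: u).
Proof.
move=> u1 c; exists (trochoid c (q + u) u 0 0), (trochoid c q u 0 0).
have eu : enorm u = 1 by apply: enorm_eq; rewrite // u1 expr1n.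
have sub t : trochoid c (q + u) u 0 0 t - trochoid c q u 0 0 t = u.
  by apply/rowP => i; rewrite !mxE; ring.
split; [split| | | |].
- exact: smooth_trochoid.
- exact: smooth_trochoid.
- by move=> t; rewrite sub.
- move=> t; exists 1.
  by rewrite sub derive1_trochoid /trochoid oppr0 !scaler0 !addr0 scale1r.
- by move=> t; rewrite derive1_trochoid /trochoid oppr0 !scaler0 !addr0.
- by rewrite trochoid_start addr0.
- by rewrite trochoid_start addr0.
- by rewrite trochoid_shift !scaler0 !addr0 addrAC.
- by rewrite trochoid_shift !scaler0 !addr0.
Qed.

(** The case q' = q takes a single rotation; it is apart because a straight ride
    of length 0 has no direction. *)
Lemma placements_joined p q p' q' : (2 <= n)%N ->
  enorm (p - q) = 1 -> enorm (p' - q') = 1 ->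
  exists2 l : R, l <= enorm (q' - q) + 4 * pi & joined l p q p' q'.
Proof.
move=> n2 /(congr1 (fun r => r ^+ 2)) pq /(congr1 (fun r => r ^+ 2)) pq'.
move: pq pq'; rewrite !enorm_sqr expr1n => pq pq'; have p0 := pi_gt0 R.
have pE : p = q + (p - q) by rewrite addrC subrK.
have pE' : p' = q' + (p' - q') by rewrite addrC subrK.
set d := enorm (q' - q).
have [qq|qq] := eqVneq q' q.
  rewrite {}qq in pq' pE' *.
  have [l /andP[l0 l2] m] := maneuver_rotate q n2 pq pq'.
  exists l; first by have := enorm_ge0 (q' - q); rewrite -/d; lra.
  by apply: maneuver_joined => //; rewrite pE pE'.
have d0 : 0 < d by rewrite enorm_gt0 subr_eq0.
pose u := d^-1 *: (q' - q).
have qE : q + d *: u = q'.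
  by rewrite scalerA divff ?gt_eqF// scale1r addrC subrK.
have u1 : dot u u = 1.
  by rewrite !dotZl !dotZr -enorm_sqr -/d expr2 mulKf ?mulVf// gt_eqF.
have [l1 /andP[l10 l1pi] m1] := maneuver_rotate q n2 pq u1.
have m2 := maneuver_straight d q u1.
have [l3 /andP[l30 l3pi] m3] := maneuver_rotate q' n2 u1 pq'.
exists (l1 + d + l3); first lra.
rewrite -pE in m1; rewrite -pE' in m3; rewrite qE in m2.
apply: joined_maneuver m3 => //; apply: joined_maneuver m2 => //.
exact: maneuver_joined.
Qed.

End Competitors.

(** * Global minimizers *)

Section Minimizers.
Context {R : realType} {n : nat}.
Implicit Types x y : R -> 'rV[R]_n.

Lemma bicycle_front_le x y (a b : R) : bicycle_path x y -> a <= b ->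
  enorm (x b - x a) <= b - a.
Proof.
move=> xy; rewrite le_eqVlt => /orP[/eqP <-|ab].
  by rewrite !subrr le_eqVlt enorm_eq0 eqxx.
have [px _ _ _ x1] := xy a b ab.
exact: front_lipschitz (ltW ab) px x1.
Qed.

Lemma bicycle_unit x y (t : R) : bicycle_path x y -> enorm (x t - y t) = 1.
Proof.
move=> xy; have tt : t < t + 1 by rewrite ltrDl.
by have [_ _ + _ _] := xy _ _ tt; apply; rewrite lexx ltW.
Qed.

Lemma minimizer_le x y (a b : R) : (2 <= n)%N -> bicycle_path x y ->
  global_minimizer x y -> a < b ->
  b - a <= enorm (x b - x a) + 2 + 4 * pi.
Proof.
move=> n2 xy gm ab.
have xy1 t := bicycle_unit t xy.
have [l lle [c [d [x' [y' [cd dcl bp [h1 h2 h3 h4]]]]]]] :=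
  placements_joined n2 (xy1 a) (xy1 b).
have := gm a b ab c d x' y' (ltW cd) bp h1 h2 h3 h4.
have [px _ _ _ x1] := xy a b ab.
have [px' _ _ _ x1'] := bp.
rewrite !curve_length_unit ?(ltW ab) ?(ltW cd)// lee_fin dcl.
move=> /le_trans; apply.
apply: le_trans lle _; rewrite lerD2r.
have := enorm_tri (x b) (y b) (y a); have := enorm_tri (x a) (x b) (y a).
by rewrite (enormB (y b) (x b)) !xy1; lra.
Qed.

(** The points x 0 and x 1 span a unit direction d, and the distances from x t
    to both of them locate x t at x 0 + t d. *)
Lemma isometric_linear x :
  (forall a b : R, a <= b -> enorm (x b - x a) = b - a) ->
  ~ non_linear x.
Proof.
move=> iso; apply; pose d := x 1 - x 0.
have sq (a b : R) : dot (x b - x a) (x b - x a) = (b - a) ^+ 2.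
  rewrite -enorm_sqr; case: (leP a b) => ab; first by rewrite iso.
  by rewrite enormB iso ?(ltW ab)//; ring.
have dd : dot d d = 1 by rewrite sq subr0 expr1n.
exists (x 0), d; split; first by rewrite -dot_eq0 dd oner_neq0.
move=> t; exists t; rewrite -(@on_unit_line _ _ d (x t - x 0) t dd).
- by rewrite addrC subrK.
- by rewrite sq subr0.
- by rewrite -sq; congr dot; rewrite /d opprB addrA subrK.
Qed.

End Minimizers.

Theorem proposition3p18 (R : realType) (n : nat) (hn : (2 <= n)%N)
    (x y : R -> 'rV[R]_n) :
  bicycle_path x y -> quasi_periodic x y -> non_linear x ->
  ~ global_minimizer x y.
Proof.
move=> xy [T [M [T0 isoM xT _]]] nl gm.
apply: (@isometric_linear R n x) nl => a b ab.
apply/eqP; rewrite eq_le (bicycle_front_le xy ab)/= leNgt; apply/negP => short.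
have ab0 : 0 < b - a by apply: le_lt_trans short; exact: enorm_ge0.
have invT m s t :
    enorm (x (s + m%:R * T) - x (t + m%:R * T)) = enorm (x s - x t).
  elim: m => [|m IH]; first by rewrite mul0r !addr0.
  by rewrite -natr1 mulrDl mul1r !addrA !xT isoM.
set k := Num.bound ((b - a) / T).
have kT : b - a < k%:R * T.
  by rewrite -ltr_pdivrMr//; apply: archi_boundP; rewrite divr_ge0 ?ltW.
set P := k%:R * T in kT.
pose eps := (b - a) - enorm (x b - x a).
have eps0 : 0 < eps by rewrite subr_gt0.
have step : enorm (x (a + P) - x a) <= P - eps.
  have bP : b <= a + P by rewrite -lerBlDl ltW.
  have := bicycle_front_le xy bP; have := enorm_tri (x b) (x (a + P)) (x a).
  by rewrite /eps; lra.
have steps m : enorm (x (a + m%:R * P) - x a) <= m%:R * (P - eps).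
  elim: m => [|m IH].
    by rewrite !mul0r addr0 subrr le_eqVlt enorm_eq0 eqxx.
  have := enorm_tri (x (a + m%:R * P)) (x (a + m.+1%:R * P)) (x a).
  rewrite (_ : a + m.+1%:R * P = a + P + (m * k)%:R * T); last first.
    by rewrite -natr1 natrM /P; ring.
  rewrite {1}(_ : a + m%:R * P = a + (m * k)%:R * T); last first.
    by rewrite natrM /P; ring.
  by rewrite invT -natr1; lra.
set m := Num.bound ((2 + 4 * pi) / eps).
have p0 := pi_gt0 R.
have big : 2 + 4 * pi < m%:R * eps.
  by rewrite -ltr_pdivrMr//; apply: archi_boundP; rewrite divr_ge0 ?ltW//; lra.
have m0 : 0 < m%:R :> R by rewrite -(pmulr_lgt0 _ eps0); lra.
have aP : a < a + m%:R * P by rewrite ltrDl mulr_gt0//; lra.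
have := minimizer_le hn xy gm aP; have := steps m.
by rewrite mulrBr; lra.
Qed.
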